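(* Let $\mathrm{DM}$ be a decomposition method, let $\mathbb{A}$ be a connected left-hand structure, and let $O=\{X_1,\dots,X_m\}\subseteq A$, $m\ge 1$, be a set of variables. Assume that $(\mathbb{A},O)$ is tp-covered through $\mathrm{DM}$. Then, for every right-hand structure $\mathbb{B}$, the algorithm $\mathtt{ComputeAllSolutions}_{\mathrm{DM}}$ run on the input $(\mathbb{A},\mathbb{B},O)$ computes the set $\mathbb{A}^{\mathbb{B}}[O]$.
   Context: **Structures and homomorphisms.** All structures are finite. A relational structure $\mathbb{A}$ over a finite vocabulary $\tau$ has a universe $A$ (whose elements are called variables when $\mathbb{A}$ is the left-hand structure) and a relation $R^{\mathbb{A}}\subseteq A^r$ for each $r$-ary $R\in\tau$. A CSP instance is a pair $(\mathbb{A},\mathbb{B})$ of structures over the same vocabulary ($\mathbb{A}$ left-hand, $\mathbb{B}$ right-hand). $\mathbb{A}^{\mathbb{B}}$ is the set of homomorphisms from $\mathbb{A}$ to $\mathbb{B}$, and $\mathbb{A}^{\mathbb{B}}[X]$ the set of their restrictions to $X\subseteq A$. An ECSP instance is a triple $(\mathbb{A},\mathbb{B},O)$ with $O\subseteq A$; the task is to compute $\mathbb{A}^{\mathbb{B}}[O]$. $\mathbb{A}\uplus\mathbb{A}'$ (disjoint vocabularies) is the structure whose vocabulary, universe and relations are the unions of those of $\mathbb{A}$ and $\mathbb{A}'$. $\mathbb{A}'$ is a substructure of $\mathbb{A}$ if $A'\subseteq A$ and $R^{\mathbb{A}'}\subseteq R^{\mathbb{A}}$ for every $R$ (not necessarily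 induced). $\mathbb{A}'$ is a core of $\mathbb{A}$ if it is a substructure of $\mathbb{A}$ such that there is a homomorphism from $\mathbb{A}$ to $\mathbb{A}'$ and no substructure of $\mathbb{A}'$ other than $\mathbb{A}'$ has this property. **Hypergraphs and tree projections.** $\mathcal{H}_{\mathbb{A}}$ is the hypergraph with node set $A$ and, for each tuple in each relation of $\mathbb{A}$, a hyperedge consisting of the variables in the tuple. $\mathbb{A}$ is connected if $\mathcal{H}_{\mathbb{A}}$ is. A hypergraph is acyclic if it has a join tree: a tree whose vertices are its hyperedges such that, whenever a node $X$ occurs in two hyperedges, $X$ occurs in every vertex on the path linking them. $\mathcal{H}_1\le\mathcal{H}_2$ means every hyperedge of $\mathcal{H}_1$ is contained in some hyperedge of $\mathcal{H}_2$. A tree projection of $(\mathcal{H}_1,\mathcal{H}_2)$ is an acyclic hypergraph $\mathcal{H}_a$ with $\mathcal{H}_1\le\mathcal{H}_a\le\mathcal{H}_2$. **Views and decomposition methods.** A view structure for $\mathbb{A}$ is a structure $\mathbb{A}_{\mathcal V}$ with universe $A$ over a vocabulary $\tau_{\mathcal V}$ disjoint from $\tau$, in which every relation contains a single tuple (whose set of variables is denoted $\mathrm{var}(R^{\mathbb{A}_{\mathcal V}})$), and such that for every $R\in\tau$ and $t\in R^{\mathbb{A}}$ there is a symbol $R_t\in\tau_{\mathcal V}$, called a base view, with $R_t^{\mathbb{A}_{\mathcal V}}=\{t\}$. A structure $\mathbb{B}_{\mathcal V}$ over $\tau_{\mathcal V}$ is legal w.r.t. $\mathbb{A}_{\mathcal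 V}$ and $(\mathbb{A},\mathbb{B})$ if for every $R\in\tau_{\mathcal V}$, $R^{\mathbb{B}_{\mathcal V}}\supseteq\mathbb{A}^{\mathbb{B}}[\mathrm{var}(R^{\mathbb{A}_{\mathcal V}})]$ (tuples identified with assignments to the variables of the view), and for every base view $R_t$ (with $t\in R^{\mathbb A}$), $R_t^{\mathbb{B}_{\mathcal V}}\subseteq R^{\mathbb{B}}$. A decomposition method $\mathrm{DM}$ is a pair of polynomial-time computable functions $\ell\text{-DM}$, $r\text{-DM}$ such that for every CSP instance $(\mathbb{A},\mathbb{B})$, $\ell\text{-DM}(\mathbb{A})$ is a view structure for $\mathbb{A}$ and $r\text{-DM}(\mathbb{A},\mathbb{B})$ is legal w.r.t. $\ell\text{-DM}(\mathbb{A})$ and $(\mathbb{A},\mathbb{B})$. **GAC.** $\mathrm{GAC}(\mathbb{A}_{\mathcal V},\mathbb{B}_{\mathcal V})$ is the right-hand structure obtained from $\mathbb{B}_{\mathcal V}$ by deleting tuples until every two views having a nonempty set $\bar X$ of common variables have the same projection on $\bar X$ (the largest such sub-structure). **tp-covered pairs.** $\mathbb{S}_{\{X\}}$ is the structure with universe $\{X\}$ and one fresh unary symbol with relation $\{\langle X\rangle\}$. $(\mathbb{A},O)$ is tp-covered through $\mathrm{DM}$ if there is a core $\mathbb{A}'$ of $\mathbb{A}\uplus\biguplus_{X\in O}\mathbb{S}_{\{X\}}$ such that $(\mathcal{H}_{\mathbb{A}'},\mathcal{H}_{\ell\text{-DM}(\mathbb{A})})$ has a tree projection. **Domain restriction.**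 A variable $X$ is domain restricted in $\mathbb{A}$ if the vocabulary contains a distinguished unary symbol $\mathrm{dom}(X)$ with $\mathrm{dom}(X)^{\mathbb{A}}=\{\langle X\rangle\}$. A domain-restricted version of $(\mathbb{A},\mathbb{B},O)$ is obtained by adding, for every $X\in O$ that is not domain restricted, a fresh unary constraint $\mathrm{dom}(X)$ on $X$ whose values in the right-hand structure are those taken from (the column of $X$ in) any constraint relation where $X$ occurs; it has the same solutions. The base view of the constraint $\mathrm{dom}(X)$ is also denoted $\mathrm{dom}(X)$. **Algorithm $\mathtt{ComputeAllSolutions}_{\mathrm{DM}}$.** Input: an ECSP instance $(\mathbb{A},\mathbb{B},O)$, $O=\{X_1,\dots,X_m\}$. Replace $(\mathbb{A},\mathbb{B},O)$ by any of its domain-restricted versions; let $\mathbb{A}_{\mathcal V}:=\ell\text{-DM}(\mathbb{A})$, $\mathbb{B}_{\mathcal V}:=r\text{-DM}(\mathbb{A},\mathbb{B})$; call $\mathtt{Propagate}(1,(\mathbb{A}_{\mathcal V},\mathbb{B}_{\mathcal V}),m,\langle\rangle)$. The procedure $\mathtt{Propagate}(i,(\mathbb{A}_{\mathcal V},\mathbb{B}_{\mathcal V}),m,\langle a_1,\dots,a_{i-1}\rangle)$ is: let $\mathbb{B}'_{\mathcal V}:=\mathrm{GAC}(\mathbb{A}_{\mathcal V},\mathbb{B}_{\mathcal V})$; let $\mathit{activeValues}:=\mathrm{dom}(X_i)^{\mathbb{B}'_{\mathcal V}}$; for each $\langle a_i\rangle\in\mathit{activeValues}$: if $i=m$, output $\langle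 a_1,\dots,a_m\rangle$; otherwise set $\mathrm{dom}(X_i)^{\mathbb{B}'_{\mathcal V}}$ to $\{\langle a_i\rangle\}$ and call $\mathtt{Propagate}(i+1,(\mathbb{A}_{\mathcal V},\mathbb{B}'_{\mathcal V}),m,\langle a_1,\dots,a_i\rangle)$. An output $\langle a_1,\dots,a_m\rangle$ represents the map $X_j\mapsto a_j$ on $O$.
   Formalization: The tp-covered hypothesis is imposed on the domain-restricted version of A, the structure on which the algorithm runs DM, not on A itself; otherwise the claim fails, since a decomposition method may give unrelated views for A and its domain-restricted version. *)

(* Defs.v *)
From mathcomp Require Import all_boot finmap.

Set Implicit Arguments.
Unset Strict Implicit.
Unset Printing Implicit Defensive.

Local Open Scope fset_scope.
Local Open Scope fmap_scope.

(** * Structures and homomorphisms *)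

(* Universe elements and symbols are drawn from countable supplies of names, so
   that structures are finite data that can be written on a tape, structures can
   share elements, and fresh symbols exist.  A symbol carries its arity. *)
Definition elt := nat.
Definition symb := (nat * nat)%type.
Definition arity (R : symb) : nat := R.2.
Definition fact := (symb * seq elt)%type.

(* [(R, t) \in facts A] means that the tuple t belongs to R^A. *)
Record structure := Structure {
  voc : {fset symb};
  univ : {fset elt};
  facts : {fset fact}
}.

Definition wf (A : structure) : Prop :=
  (forall R, R \in voc A -> 0 < arity R) /\
  (forall f : fact, f \in facts A ->
     [/\ f.1 \in voc A, size f.2 = arity f.1 & {subset f.2 <= univ A}]).

Definition interp (A : structure) (R : symb) : {fset seq elt} :=
  [fset f.2 | f in facts A & f.1 == R].

Definition csp_instance (A B : structure) : Prop :=
  [/\ wf A, wf B & voc A = voc B].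

(* Only the values of h on the universe of A are relevant. *)
Definition hom (A B : structure) (h : elt -> elt) : Prop :=
  {in univ A, forall x, h x \in univ B} /\
  (forall R t, (R, t) \in facts A -> (R, map h t) \in facts B).

(* A^B[X] for the set X of the elements listed in xs: a map on X is identified
   with the tuple of its values along xs. *)
Definition restricted_homs (A B : structure) (xs a : seq elt) : Prop :=
  exists2 h, hom A B h & a = map h xs.

Definition sunion (A A' : structure) : structure :=
  Structure (voc A `|` voc A') (univ A `|` univ A') (facts A `|` facts A').

Definition empty_structure : structure := Structure fset0 fset0 fset0.

Definition unary_structure (s : symb) (V : {fset elt}) : structure :=
  Structure [fset s] V [fset (s, [:: v]) | v in V].

Definition substructure (A' A : structure) : Prop :=
  [/\ wf A', voc A' = voc A, univ A' `<=` univ A & facts A' `<=` facts A].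

Definition is_core (A' A : structure) : Prop :=
  [/\ substructure A' A,
      exists h, hom A A' h &
      forall A'', substructure A'' A' -> A'' <> A' -> ~ exists h, hom A A'' h].

(** * Hypergraphs and tree projections *)

Record hypergraph := Hypergraph {
  nodes : {fset elt};
  hedges : {fset {fset elt}}
}.

Definition wf_hypergraph (H : hypergraph) : Prop :=
  {in hedges H, forall e : {fset elt}, e `<=` nodes H}.

Definition hypergraph_of (A : structure) : hypergraph :=
  Hypergraph (univ A) [fset [fset x in (f.2 : seq elt)] | f : fact in facts A].

Definition adjacent (H : hypergraph) : rel elt :=
  fun x y => has (fun e : {fset elt} => (x \in e) && (y \in e)) (hedges H).

Definition hconnected (H : hypergraph) : Prop :=
  {in nodes H &, forall x y, exists2 p, path (adjacent H) x p & last x p = y}.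

Definition is_tree (T : choiceType) (V : {fset T}) (E : rel T) : Prop :=
  [/\ forall u v, E u v -> [/\ u \in V, v \in V, u != v & E v u],
      {in V &, forall u v, exists2 p, path E u p & last u p = v} &
      forall c, cycle E c -> uniq c -> size c <= 2].

Definition is_join_tree (H : hypergraph) (E : rel {fset elt}) : Prop :=
  is_tree (hedges H) E /\
  forall (u : {fset elt}) (p : seq {fset elt}) (x : elt),
    u \in hedges H -> path E u p -> uniq (u :: p) ->
    x \in u -> x \in last u p -> {in p, forall w : {fset elt}, x \in w}.

Definition acyclic (H : hypergraph) : Prop := exists E, is_join_tree H E.

Definition hle (H1 H2 : hypergraph) : Prop :=
  {in hedges H1, forall e1, exists2 e2, e2 \in hedges H2 & e1 `<=` e2}.

Definition has_tree_projection (H1 H2 : hypergraph) : Prop :=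
  exists Ha, [/\ wf_hypergraph Ha, acyclic Ha, hle H1 Ha & hle Ha H2].

(** * Views *)

(* [vbase] maps each fact (R, t) of the viewed structure to its base view R_t. *)
Record views := Views {
  vstruct :> structure;
  vbase : {fmap fact -> symb}
}.

Definition view_structure (AV : views) (A : structure) : Prop :=
  [/\ wf AV, univ AV = univ A, [disjoint voc AV & voc A]%fset,
      forall R, R \in voc AV -> exists t, interp AV R = [fset t] &
      domf (vbase AV) = facts A /\
      forall R t S, (vbase AV).[? (R, t)] = Some S ->
        S \in voc AV /\ interp AV S = [fset t]].

Definition legal (BV : structure) (AV : views) (A B : structure) : Prop :=
  [/\ wf BV, voc BV = voc AV,
      forall R t, (R, t) \in facts AV ->
        forall u, restricted_homs A B t u -> u \in interp BV R &
      forall R t S, (vbase AV).[? (R, t)] = Some S ->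
        interp BV S `<=` interp B R].

(** * Polynomial-time computability *)

(* inl b is the bit b; inr false and inr true are the opening and closing
   parentheses. *)
Definition letter : finType := (bool + bool)%type.
Definition word := seq letter.

Definition enc_seq (ws : seq word) : word :=
  inr false :: flatten ws ++ [:: inr true].

(* Binary notation, least significant bit first. *)
Definition enc_nat (n : nat) : word :=
  enc_seq [seq [:: inl (odd (n %/ 2 ^ i))] | i <- iota 0 (up_log 2 n.+1)].

Definition enc_symb (R : symb) : word := enc_seq [:: enc_nat R.1; enc_nat R.2].

Definition enc_fact (f : fact) : word :=
  enc_seq [:: enc_symb f.1; enc_seq (map enc_nat f.2)].

(* The encodings are relations since a set may be listed in any order. *)
Definition encodes_structure (A : structure) (w : word) : Prop :=
  exists us rs fs,
    [/\ perm_eq us (univ A), perm_eq rs (voc A), perm_eq fs (facts A) &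
        w = enc_seq [:: enc_seq (map enc_nat us); enc_seq (map enc_symb rs);
                        enc_seq (map enc_fact fs)]].

Definition encodes_views (AV : views) (w : word) : Prop :=
  exists w0 (bs : seq (fact * symb)),
    [/\ encodes_structure AV w0, perm_eq (map fst bs) (domf (vbase AV)),
        {in bs, forall b, (vbase AV).[? b.1] = Some b.2} &
        w = enc_seq [:: w0; enc_seq [seq enc_seq [:: enc_fact b.1; enc_symb b.2]
                                    | b <- bs]]].

Definition encodes_pair (AB : structure * structure) (w : word) : Prop :=
  exists w1 w2, [/\ encodes_structure AB.1 w1, encodes_structure AB.2 w2 &
                    w = enc_seq [:: w1; w2]].

(* Deterministic machines with a single two-way infinite tape.  A cell is blank
   (None), or holds a letter or an auxiliary symbol.  A step yields the new
   state, the symbol written, and the direction of the move (true = right). *)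
Record turing_machine := TuringMachine {
  tm_state : finType;
  tm_aux : finType;
  tm_init : tm_state;
  tm_halt : pred tm_state;
  tm_step : tm_state -> option (letter + tm_aux) ->
            tm_state * option (letter + tm_aux) * bool
}.

Section Execution.
Variable M : turing_machine.

Definition cell := option (letter + tm_aux M).

(* (q, (l, r)): r is the tape from the head rightwards, l is the tape to the left
   of the head, nearest cell first; both are followed by blanks. *)
Definition config := (tm_state M * (seq cell * seq cell))%type.

Definition tm_next (c : config) : config :=
  let: (q, (l, r)) := c in
  if tm_halt q then c else
  let: (q', s, to_right) := tm_step q (head None r) in
  if to_right then (q', (s :: l, behead r))
  else (q', (behead l, head None l :: s :: behead r)).

Definition tape_of (w : word) : seq cell := [seq Some (inl x) | x <- w].

Definition tm_computes (w : word) (n : nat) (w' : word) : Prop :=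
  let c := iter n tm_next (tm_init M, ([::], tape_of w)) in
  tm_halt c.1 /\ exists k, c.2.2 = tape_of w' ++ nseq k None.

End Execution.

Definition polytime (X Y : Type) (valid : X -> Prop)
    (encX : X -> word -> Prop) (encY : Y -> word -> Prop) (f : X -> Y) : Prop :=
  exists (M : turing_machine) (k : nat), forall x w, valid x -> encX x w ->
    exists n w', [/\ n <= k * size w ^ k + k, tm_computes M w n w' &
                     encY (f x) w'].

(** * Decomposition methods *)

Record decomposition_method := DecompositionMethod {
  lDM : structure -> views;
  rDM : structure -> structure -> structure;
  lDM_polytime : polytime wf encodes_structure encodes_views lDM;
  rDM_polytime :
    polytime (fun AB => csp_instance AB.1 AB.2) encodes_pair encodes_structure
             (fun AB => rDM AB.1 AB.2);
  lDM_views : forall A B, csp_instance A B -> view_structure (lDM A) A;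
  rDM_legal : forall A B, csp_instance A B -> legal (rDM A B) (lDM A) A B
}.

(* fr X is the fresh symbol of the structure on the single variable X. *)
Definition tp_covered (DM : decomposition_method) (A : structure)
    (O : {fset elt}) : Prop :=
  exists fr : elt -> symb,
    [/\ {in O, forall X, fr X \notin voc A /\ arity (fr X) = 1},
        {in O &, injective fr} &
        exists2 A' : structure,
          is_core A' (sunion A (\big[sunion/empty_structure]_(X <- O)
                                   unary_structure (fr X) [fset X])) &
          has_tree_projection (hypergraph_of A') (hypergraph_of (lDM DM A))].

(** * Generalized arc consistency *)

(* A tuple u in the relation of a view with tuple of variables t stands for the
   assignment mapping the i-th entry of t to the i-th entry of u.  If t has
   repeated variables, u need not define an assignment, and then stands for
   nothing. *)
Definition value_at (t u : seq elt) (x : elt) : elt := nth 0 u (index x t).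

Definition is_assignment (t u : seq elt) : bool := u == map (value_at t u) t.

Definition projection (xs : seq elt) (BV : structure) (v : fact) :
    {fset seq elt} :=
  [fset map (value_at v.2 u) xs | u in interp BV v.1 & is_assignment v.2 u].

Definition pairwise_consistent (AV BV : structure) : bool :=
  all (fun v => all (fun v' =>
    let xs := [seq x <- v.2 | x \in v'.2] in
    (xs != [::]) ==> (projection xs BV v == projection xs BV v'))
    (facts AV)) (facts AV).

Definition with_facts (B : structure) (D : {fset fact}) : structure :=
  Structure (voc B) (univ B) D.

(* Pairwise consistent sets of facts are closed under union, so this is the
   largest one. *)
Definition GAC (AV BV : structure) : structure :=
  with_facts BV
    (\bigcup_(D <- fpowerset (facts BV)
             | pairwise_consistent AV (with_facts BV D)) D).

(** * Domain restriction *)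

(* [dom X] is the symbol distinguished as the domain constraint of X. *)
Definition domain_restricted (dom : elt -> symb) (A : structure) (X : elt) :
    bool :=
  [&& dom X \in voc A, arity (dom X) == 1 & interp A (dom X) == [fset [:: X]]].

Definition unrestricted (dom : elt -> symb) (A : structure) (O : {fset elt}) :
    {fset elt} :=
  [fset X in O | ~~ domain_restricted dom A X].

Definition fresh_dom (dom : elt -> symb) (A : structure) (O : {fset elt}) :
    Prop :=
  {in unrestricted dom A O, forall X, dom X \notin voc A /\ arity (dom X) = 1} /\
  {in unrestricted dom A O &, injective dom}.

(* V is the column of X in some constraint relation where X occurs; a variable
   that occurs in no constraint may take every value. *)
Definition domain_values (A B : structure) (X : elt) (V : {fset elt}) : Prop :=
  (exists R t i, [/\ (R, t) \in facts A, i < size t, nth 0 t i = X &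
                     V = [fset nth 0 u i | u in interp B R]]) \/
  ((forall f : fact, f \in facts A -> X \notin f.2) /\ V = univ B).

Definition dom_left (dom : elt -> symb) (A : structure) (O : {fset elt}) :
    structure :=
  sunion A (\big[sunion/empty_structure]_(X <- unrestricted dom A O)
               unary_structure (dom X) [fset X]).

Definition dom_right (dom : elt -> symb) (vals : elt -> {fset elt})
    (A B : structure) (O : {fset elt}) : structure :=
  sunion B (\big[sunion/empty_structure]_(X <- unrestricted dom A O)
               unary_structure (dom X) (vals X)).

(** * The algorithm *)

Definition set_unary (BV : structure) (s : symb) (a : elt) : structure :=
  with_facts BV ((s, [:: a]) |` [fset f in facts BV | f.1 != s]).

(* domv X is the base view dom(X), as the prefix of values already chosen, xs the
   list of the variables still to be processed. *)
Fixpoint propagate (domv : elt -> symb) (AV BV : structure)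
    (prefix xs : seq elt) : seq (seq elt) :=
  if xs is X :: xs' then
    let BV' := GAC AV BV in
    let active_values := [seq head 0 u | u <- interp BV' (domv X)] in
    if xs' is [::] then [seq rcons prefix a | a <- active_values]
    else flatten [seq propagate domv AV (set_unary BV' (domv X) a)
                                (rcons prefix a) xs'
                 | a <- active_values]
  else [::].

(* The base view of a fact, with a junk default outside the domain of vbase. *)
Definition base_view (AV : views) (f : fact) : symb :=
  odflt (0, 0) (vbase AV).[? f].

(* The list of outputs; dom and vals determine the domain-restricted version that
   the algorithm works on.  DM is applied to that version: nothing relates
   lDM DM A to lDM DM (dom_left dom A O) unless A is already domain restricted. *)
Definition ComputeAllSolutions (DM : decomposition_method) (dom : elt -> symb)
    (vals : elt -> {fset elt}) (A B : structure) (xs : seq elt) :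
    seq (seq elt) :=
  let O := [fset X in xs] in
  let A1 := dom_left dom A O in
  let B1 := dom_right dom vals A B O in
  let AV := lDM DM A1 in
  propagate (fun X => base_view AV (dom X, [:: X])) AV (rDM DM A1 B1) [::] xs.

(* Main.v *)
(* Every homomorphism satisfies the views, its trace on the views is pairwise
   consistent, hence GAC never deletes it and the algorithm outputs it.
   Conversely let the views be pairwise consistent and let a be an active value
   of dom(X).  The fresh unary constraints force a homomorphism h from the
   structure to its core A' to fix O; since A' = h(A) is connected, all views
   that meet A' are nonempty.  A view above each hyperedge of the tree projection
   restricts to a relation on that hyperedge, and along the join tree, rooted at
   a hyperedge containing X, the assignment X |-> a extends to one satisfying all
   these relations, hence all base views of the constraints in A'.  Composed with
   h, it is a homomorphism that maps each Y in O to a value in dom(Y), and this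
   value is the chosen one if Y has been processed before. *)

Require Import Defs.
From mathcomp Require Import all_boot finmap.

Set Implicit Arguments.
Unset Strict Implicit.
Unset Printing Implicit Defensive.

Local Open Scope fset_scope.

(** * Membership in relations, hypergraphs and unions of unary structures *)

Lemma in_interp (A : structure) (R : symb) (t : seq elt) :
  (t \in interp A R) = ((R, t) \in facts A).
Proof.
apply/imfsetP/idP => [[[S u] /= /[!inE] /andP[fA /eqP <-] ->] // | fA].
by exists (R, t); rewrite //= inE fA /=.
Qed.

Lemma in_hypergraph_of (A : structure) (e : {fset elt}) :
  reflect (exists2 f : fact, f \in facts A & e =i f.2)
          (e \in hedges (hypergraph_of A)).
Proof.
rewrite /=; apply: (iffP (imfsetP _ _ _ _)) => -[f /= fA e_f]; exists f => //.
  by move=> x; rewrite e_f !inE.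
by apply/fsetP => x; rewrite e_f !inE.
Qed.

Section BigUnary.
Variables (c : elt -> symb) (V : elt -> {fset elt}).

Definition unaries (s : seq elt) : structure :=
  \big[sunion/empty_structure]_(X <- s) unary_structure (c X) (V X).

Lemma voc_unaries s R :
  reflect (exists2 X, X \in s & R = c X) (R \in voc (unaries s)).
Proof.
rewrite /unaries; elim: s R => [R|X s IHs R].
  by rewrite big_nil inE; constructor; case.
rewrite big_cons /= !inE; apply: (iffP orP) => [[/eqP ->|/IHs[Y sY ->]]|].
- by exists X; rewrite ?mem_head.
- by exists Y; rewrite // inE sY orbT.
move=> [Y /[!inE] /orP[/eqP->|sY] ->]; first by left.
by right; apply/IHs; exists Y.
Qed.

Lemma univ_unaries s x :
  reflect (exists2 X, X \in s & x \in V X) (x \in univ (unaries s)).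
Proof.
rewrite /unaries; elim: s => [|X s IHs].
  by rewrite big_nil inE; constructor; case.
rewrite big_cons /= !inE; apply: (iffP orP) => [[xX|/IHs[Y sY xY]]|].
- by exists X; rewrite ?mem_head.
- by exists Y; rewrite // inE sY orbT.
move=> [Y /[!inE] /orP[/eqP->|sY] xY]; first by left.
by right; apply/IHs; exists Y.
Qed.

Lemma facts_unaries s R t :
  reflect (exists X v, [/\ X \in s, v \in V X, R = c X & t = [:: v]])
          ((R, t) \in facts (unaries s)).
Proof.
rewrite /unaries; elim: s R t => [R t|X s IHs R t].
  by rewrite big_nil inE; constructor => -[? [? []]].
rewrite big_cons /= inE.
apply: (iffP orP) => [[/imfsetP[v /= vX [-> ->]]|/IHs[Y [v [sY vY -> ->]]]]|].
- by exists X, v; rewrite mem_head.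
- by exists Y, v; rewrite inE sY orbT.
move=> [Y [v [/[!inE] /orP[/eqP->|sY] vY -> ->]]].
  by left; apply/imfsetP; exists v.
by right; apply/IHs; exists Y, v.
Qed.

Lemma wf_unaries s :
  {in s, forall X, arity (c X) = 1} -> wf (unaries s).
Proof.
move=> ar; split=> [R /voc_unaries[X sX ->]|[R t]]; first by rewrite ar.
move=> /facts_unaries[X [v [sX vX -> ->]]] /=; split.
- by apply/voc_unaries; exists X.
- by rewrite ar.
by move=> x /[!inE] /eqP ->; apply/univ_unaries; exists X.
Qed.

End BigUnary.

Lemma wf_sunion A A' : wf A -> wf A' -> wf (sunion A A').
Proof.
move=> [arA fA] [arA' fA']; split=> [R|f] /[!inE] /orP[].
- exact: arA.
- exact: arA'.
- move=> /fA[? ? sub]; split=> //=; rewrite ?inE; first by apply/orP; left.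
  by move=> x /sub; rewrite inE => ->.
move=> /fA'[? ? sub]; split=> //=; rewrite ?inE; first by apply/orP; right.
by move=> x /sub; rewrite inE => ->; rewrite orbT.
Qed.

(** * Domain restriction *)

Section DomainRestriction.
Variables (A B : structure) (O : {fset elt}).
Variables (dom : elt -> symb) (vals : elt -> {fset elt}).
Hypotheses (ABinst : csp_instance A B) (sOA : O `<=` univ A).
Hypothesis dom_fresh : fresh_dom dom A O.
Hypothesis vals_dom :
  {in unrestricted dom A O, forall X, domain_values A B X (vals X)}.

Let U : {fset elt} := unrestricted dom A O.
Let A1 := dom_left dom A O.
Let B1 := dom_right dom vals A B O.

Let arU : {in U, forall X, arity (dom X) = 1}.
Proof. by move=> X UX; case: dom_fresh => /(_ X UX)[]. Qed.

Lemma csp_instance_dom : csp_instance A1 B1.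
Proof.
have [wfA wfB vocAB] := ABinst; split.
- by apply: wf_sunion => //; apply: wf_unaries.
- by apply: wf_sunion => //; apply: wf_unaries.
apply/fsetP => R; rewrite !inE vocAB; congr (_ || _).
by apply/voc_unaries/voc_unaries.
Qed.

Lemma univ_dom_left : univ A1 = univ A.
Proof.
apply/fsetP => x; rewrite inE; case: (boolP (x \in univ A)) => //= xA.
apply/univ_unaries => -[X /[!inE] /andP[OX _] /eqP x_X].
by move: xA; rewrite x_X (fsubsetP sOA).
Qed.

(** If [X] is already restricted, freshness keeps the added symbols apart from [dom X]; otherwise
    freshness excludes facts of [A], and injectivity the other added facts. *)
Lemma dom_fact X t : X \in O -> (dom X, t) \in facts A1 <-> t = [:: X].
Proof.
move=> OX; have [wfA _ _] := ABinst; rewrite inE.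
have [res|unres] := boolP (domain_restricted dom A X).
  have [dA _ /eqP iA] := and3P res; rewrite -in_interp iA inE.
  split=> [/orP[/eqP//|/facts_unaries[Y [v [UY _ eXY _]]]]|->]; last by rewrite eqxx.
  by have [/(_ Y UY)[]] := dom_fresh; rewrite -eXY dA.
have UX : X \in U by rewrite /U !inE OX.
have [fresh inj_dom] := dom_fresh.
split=> [/orP[/wfA.2[/=]|]|->].
- by move=> dA; have [/negP] := fresh X UX.
- move=> /facts_unaries[Y [v [UY /[!inE] /eqP -> eXY ->]]].
  by rewrite (inj_dom _ _ UX UY eXY).
apply/orP; right; apply/facts_unaries.
by exists X, X; rewrite inE.
Qed.

Lemma vals_univ X x : X \in U -> x \in vals X -> x \in univ B.
Proof.
have [wfA wfB vocAB] := ABinst.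
move=> UX; have [[R [t [i [fA lt_i _ ->]]]]|[_ -> //]] := vals_dom UX.
move=> /imfsetP[u /= + ->]; rewrite in_interp => /wfB.2[/= _ size_u sub_u].
by have [/= _ size_t _] := wfA.2 _ fA; rewrite sub_u // mem_nth // size_u -size_t.
Qed.

(** The added constraints exclude nothing: a homomorphism maps a fact through [X] to a fact of [B],
    which puts [h X] in the column chosen as [vals X]. Conversely, no fact of [A] carries an added
    symbol, so its image must lie in [B]. *)
Lemma hom_dom h : hom A1 B1 h <-> hom A B h.
Proof.
have [wfA wfB vocAB] := ABinst; split=> -[h_univ h_facts]; split.
- move=> x xA; have := h_univ x; rewrite univ_dom_left => /(_ xA).
  rewrite inE => /orP[//|/univ_unaries[X UX]]; exact: vals_univ.
- move=> R t fA; have := h_facts R t; rewrite inE fA => /(_ isT).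
  rewrite inE => /orP[//|/facts_unaries[X [v [UX _ eR _]]]].
  have [RA _ _] := wfA.2 _ fA.
  by have [/(_ X UX)[]] := dom_fresh; rewrite -eR RA.
- by move=> x; rewrite univ_dom_left => /h_univ hx; rewrite inE hx.
move=> R t; rewrite !inE => /orP[/h_facts -> //|].
move=> /facts_unaries[X [v [UX /[!inE] /eqP -> -> ->]]].
apply/orP; right; apply/facts_unaries; exists X, (h X); split=> //.
have [[S [u [i [fA lt_i <- ->]]]]|[_ ->]] := vals_dom UX.
  apply/imfsetP; exists (map h u); last by rewrite (nth_map 0).
  by rewrite /= in_interp h_facts.
by apply: h_univ; apply: (fsubsetP sOA); move: UX; rewrite !inE => /andP[].
Qed.

End DomainRestriction.

(** * Pairwise consistency *)

(** Turns equality of projections into the extension of one tuple from view to view, the form in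
    which consistency is used; [x] witnesses that the two views share a variable. *)
Lemma pairwise_consistentP (AV BV : structure) :
  reflect
    (forall R t S w x, (R, t) \in facts AV -> (S, w) \in facts AV ->
      x \in t -> x \in w ->
      forall u, (R, u) \in facts BV -> is_assignment t u ->
      exists u', [/\ (S, u') \in facts BV, is_assignment w u' &
        forall y, y \in t -> y \in w -> value_at w u' y = value_at t u y])
    (pairwise_consistent AV BV).
Proof.
apply: (iffP allP) => [cons R t S w x Rt Sw xt xw u Ru tu|cons [R t] Rt].
  have /allP/(_ _ Sw)/implyP/= := cons _ Rt.
  case: eqP => [e _|_ /(_ isT)/eqP/fsetP e].
    have : x \in [seq x <- t | x \in w] by rewrite mem_filter xw.
    by rewrite e.
  set xs := [seq x <- t | x \in w] in e.
  have : map (value_at t u) xs \in projection xs BV (R, t).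
    by apply/imfsetP; exists u; rewrite //= !inE in_interp Ru.
  rewrite e => /imfsetP[u' /= /[!inE] /andP[Su' wu'] eq_u].
  exists u'; split=> //; first by rewrite -in_interp.
  move=> y yt yw; apply/esym; move/eq_in_map: eq_u; apply.
  by rewrite mem_filter yw.
apply/allP => -[S w] Sw; apply/implyP=> /=; set xs := [seq _ <- _ | _].
case exs: xs => [//|x xs'] _; rewrite -exs.
have /andP[xw xt] : (x \in w) && (x \in t).
  by rewrite -[_ && _](mem_filter (mem w)) -/xs exs mem_head.
apply/eqP/fsetP => a; apply/imfsetP/imfsetP => -[u /= /[!inE]];
    rewrite in_interp => /andP[Ru tu] ->.
  have [u' [Su' wu' eq_u]] := cons _ _ _ _ _ Rt Sw xt xw u Ru tu.
  exists u'; first by rewrite /= !inE in_interp Su'.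
  by apply/eq_in_map=> y; rewrite mem_filter => /andP[yw yt]; rewrite eq_u.
have [u' [Su' wu' eq_u]] := cons _ _ _ _ _ Sw Rt xw xt u Ru tu.
exists u'; first by rewrite /= !inE in_interp Su'.
by apply/eq_in_map=> y; rewrite mem_filter => /andP[yw yt]; rewrite eq_u.
Qed.

Lemma in_GAC (AV BV : structure) f :
  reflect (exists D, [/\ D `<=` facts BV,
             pairwise_consistent AV (with_facts BV D) & f \in D])
          (f \in facts (GAC AV BV)).
Proof.
apply: (iffP idP) => [/bigfcupP[D /andP[+ cD] fD]|[D [sD cD fD]]].
  by rewrite fpowersetE; exists D.
by apply/bigfcupP; exists D; rewrite // fpowersetE sD.
Qed.

Lemma GAC_sub (AV BV : structure) : facts (GAC AV BV) `<=` facts BV.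
Proof. by apply/fsubsetP => f /in_GAC[D [/fsubsetP sD _ /sD]]. Qed.

(** A tuple of the union lies in some consistent [D], and the partner it needs is already in that
    [D]. *)
Lemma GAC_consistent (AV BV : structure) : pairwise_consistent AV (GAC AV BV).
Proof.
apply/pairwise_consistentP => R t S w x Rt Sw xt xw u /in_GAC[D [sD cD Du]] tu.
have /pairwise_consistentP/(_ R t S w x Rt Sw xt xw u Du tu) := cD.
by move=> [u' [Du' wu' eq_u]]; exists u'; split=> //; apply/in_GAC; exists D.
Qed.

Lemma value_at_map (s : elt -> elt) (t : seq elt) x :
  x \in t -> value_at t (map s t) x = s x.
Proof. by move=> xt; rewrite /value_at (nth_map 0) ?index_mem ?nth_index. Qed.

Lemma is_assignment_map (s : elt -> elt) (t : seq elt) : is_assignment t (map s t).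
Proof. by apply/eqP/eq_in_map => x xt; rewrite value_at_map. Qed.

(** * Join trees *)

(* The assignment is extended along a set S of hyperedges that grows from e0 and
   stays connected in the tree: if v is adjacent to u in S, then the path in S
   from any w in S to u extends to v, so that the common nodes of v and w
   belong to u. *)
Lemma join_tree_extension (H : hypergraph) (E : rel {fset elt})
    (r : {fset elt} -> (elt -> elt) -> Prop) (e0 : {fset elt}) s0 :
  is_join_tree H E -> e0 \in hedges H ->
  (forall (e : {fset elt}) s s', {in e, s =1 s'} -> r e s -> r e s') ->
  (forall (e e' : {fset elt}) s, e \in hedges H -> e' \in hedges H -> r e s ->
     exists2 s', r e' s' & forall x, x \in e -> x \in e' -> s' x = s x) ->
  r e0 s0 ->
  exists2 s, {in e0, s =1 s0} & {in hedges H, forall e, r e s}.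
Proof.
move=> [[E_sym E_conn _] E_join] He0 r_ext r_step r0.
have grow n : n < size (hedges H) -> exists (S : seq {fset elt}) s,
    [/\ size S = n.+1, uniq S, {subset S <= hedges H} & e0 \in S] /\
    [/\ {in S &, forall w u, exists p, [/\ path E w p, last w p = u & {subset p <= S}]},
        {in e0, s =1 s0} & {in S, forall e, r e s}].
  elim: n => [|n IHn] lt_n.
    exists [:: e0], s0; split; split=> //.
    - by move=> e /[!inE] /eqP->.
    - by rewrite inE.
    - by move=> w u /[!inE] /eqP-> /eqP->; exists [::].
    by move=> e /[!inE] /eqP->.
  have [S [s [[sizeS uniqS subS Se0] [connS s_e0 rS]]]] := IHn (ltnW lt_n).
  have [v Hv Sv] : exists2 v, v \in hedges H & v \notin S.
    apply/allPn; apply: contraTN lt_n => /allP sub.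
    by rewrite -leqNgt -sizeS uniq_leq_size ?fset_uniq.
  (* The tree path from [e0] to [v] must leave [S]; its first exit is the new edge. *)
  have [u [w [Su Sw Euw]]] : exists u w, [/\ u \in S, w \notin S & E u w].
    have [p pth last_p] := E_conn _ _ He0 Hv.
    have : last e0 p \notin S by rewrite last_p.
    elim: p {last_p} (e0) Se0 pth => [|w p IHp] u Su /=; first by rewrite Su.
    move=> /andP[Euw pth] last_p; have [Sw|Sw] := boolP (w \in S).
      exact: IHp Sw pth last_p.
    by exists u, w.
  have [Hu Hw _ Ewu] := E_sym _ _ Euw.
  have common x w' : w' \in S -> x \in w' -> x \in w -> x \in u.
    move=> Sw' xw' xw; have [p [pth + subp]] := connS _ _ Sw' Su.
    case/shortenP: pth => q pth uniq_q sub_q last_q.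
    have Hq : w \notin w' :: q.
      by rewrite inE; apply: contra Sw => /orP[/eqP->//|/sub_q/subp].
    have : {in rcons q w, forall y : {fset elt}, x \in y}.
      apply: (E_join w') => //; first exact: subS.
      - by rewrite rcons_path pth last_q.
      - by rewrite -rcons_cons rcons_uniq Hq.
      - by rewrite last_rcons.
    case/lastP: q last_q {pth uniq_q sub_q Hq} => [<- //|q z].
    by rewrite last_rcons => <-; apply; rewrite !(mem_rcons, inE) eqxx orbT.
  have [s' r_s' s's] := r_step u w s Hu Hw (rS u Su).
  (* Only values on [w] change, and by [common] every node that [w] shares with a hyperedge of [S]
     lies in [u], where [s'] agrees with [s]. *)
  exists (w :: S), (fun x => if x \in w then s' x else s x); split; split=> //=.
  - by rewrite sizeS.
  - by rewrite Sw.
  - by move=> e /[!inE] /orP[/eqP->|/subS].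
  - by rewrite inE Se0 orbT.
  - move=> e e' /[!inE] /orP[/eqP->|Se] /orP[/eqP->|Se'].
    + by exists [::].
    + have [p [pth <- sub]] := connS _ _ Su Se'.
      exists (u :: p); split=> //=; first by rewrite Ewu.
      by move=> x /[!inE] /orP[/eqP->|/sub->]; rewrite ?Su orbT.
    + have [p [pth eu sub]] := connS _ _ Se Su.
      exists (rcons p w); rewrite rcons_path last_rcons pth eu; split=> //.
      by move=> x; rewrite mem_rcons !inE => /orP[->//|/sub->]; rewrite orbT.
    + have [p [pth eu sub]] := connS _ _ Se Se'.
      by exists p; split=> // x /sub /[!inE] ->; rewrite orbT.
  - move=> x x0; case: ifP => xw; last exact: s_e0.
    by rewrite (s's x) ?s_e0 // (common _ _ Se0).
  move=> e /[!inE] /orP[/eqP->|Se].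
    by apply: r_ext r_s' => x ->.
  apply: r_ext (rS e Se) => x xe; case: ifP => // xw.
  by rewrite (s's x) // (common _ _ Se).
have lt_n : (size (hedges H)).-1 < size (hedges H).
  by rewrite ltn_predL -has_predT; apply/hasP; exists e0.
have [S [s [[sizeS uniqS subS Se0] [_ s_e0 rS]]]] := grow _ lt_n.
exists s => // e He; apply: rS.
have [|_ ->//] := uniq_min_size uniqS subS.
by rewrite sizeS leqSpred.
Qed.

(** * Consistent views and homomorphisms *)

(** Transfers connectedness to the domain-restricted version, which adds facts but no variables. *)
Lemma hconnected_sub (A A1 : structure) :
  univ A1 = univ A -> facts A `<=` facts A1 ->
  hconnected (hypergraph_of A) -> hconnected (hypergraph_of A1).
Proof.
move=> eq_univ /fsubsetP sAA1 conn x y /=; rewrite eq_univ => xA yA.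
have [p pth <-] := conn x y xA yA; exists p => //.
apply: sub_path pth => u v /hasP[e /in_hypergraph_of[f fA e_f] uv].
by apply/hasP; exists e => //; apply/in_hypergraph_of; exists f; rewrite ?sAA1.
Qed.

(** The image of [A] under [h] is a substructure of [A'] that receives a homomorphism from [A], so
    by minimality it is [A']. *)
Lemma core_univ (A' A : structure) h :
  wf A -> is_core A' A -> hom A A' h ->
  {in univ A', forall y, exists2 x, x \in univ A & y = h x}.
Proof.
move=> wfA [[wfA' vocA' _ _] _ minA'] [h_univ h_facts].
pose I := Structure (voc A) [fset h x | x in univ A]
                    [fset (f.1, map h f.2) | f in facts A].
have subI : substructure I A'.
  split=> //=.
  - split=> [|f /imfsetP[g /= gA ->]] /=; first exact: wfA.1.
    have [vg sg ug] := wfA.2 _ gA; rewrite size_map; split=> //.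
    by move=> x /mapP[z /ug zA ->]; apply/imfsetP; exists z.
  - by apply/fsubsetP => x /imfsetP[z /h_univ ? ->].
  - by apply/fsubsetP => f /imfsetP[[R t] /h_facts ? ->].
have homI : hom A I h.
  split=> [x xA|R t fA]; apply/imfsetP; first by exists x.
  by exists (R, t).
have [<- y /imfsetP[x xA ->]|neq] := eqVneq (univ I) (univ A').
  by exists x.
have /(minA' I subI)[] : I <> A' by move=> eqI; rewrite eqI eqxx in neq.
by exists h.
Qed.

(** * Views of a fixed instance and completeness of propagation *)

Section Views.
Variables (A B : structure) (AV : views) (BV0 : structure).
Variables (O : {fset elt}) (dom : elt -> symb).
Hypotheses (ABinst : csp_instance A B) (AVview : view_structure AV A).
Hypothesis BV0legal : legal BV0 AV A B.
Hypothesis dom_facts : {in O, forall X, (dom X, [:: X]) \in facts A}.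

Let domv X := base_view AV (dom X, [:: X]).

Lemma view_unique S t w : (S, t) \in facts AV -> (S, w) \in facts AV -> w = t.
Proof.
have [wfAV _ _ one _] := AVview => St Sw.
have [/= SV _ _] := wfAV.2 _ St; have [v iS] := one _ SV.
by move: St Sw; rewrite -!in_interp iS !inE => /eqP-> /eqP->.
Qed.

Lemma base_viewP R t : (R, t) \in facts A ->
  (base_view AV (R, t), t) \in facts AV /\
  interp BV0 (base_view AV (R, t)) `<=` interp B R.
Proof.
have [_ _ _ _ [eq_dom vb]] := AVview; have [_ _ _ base] := BV0legal.
(* The domain of [vbase] is [facts A], so the default in [base_view] is never reached. *)
rewrite -eq_dom /base_view => Rt; have := in_fnd Rt; move: (_.[_]%fmap) => S vS.
rewrite vS /=; have [_ iS] := vb _ _ _ vS; split; last exact: base vS.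
by rewrite -in_interp iS inE.
Qed.

Lemma propagate_complete h (xs : seq elt) BV prefix :
  {subset xs <= O} -> xs != [::] ->
  (forall R t, (R, t) \in facts AV -> (R, map h t) \in facts BV) ->
  prefix ++ map h xs \in propagate domv AV BV prefix xs.
Proof.
elim: xs BV prefix => // X xs IHxs BV prefix sO _ hBV /=.
have OX : X \in O by rewrite sO ?mem_head.
have [vX _] := base_viewP (dom_facts OX).
pose D := [fset (f.1, map h f.2) | f in facts AV].
have hGAC R t : (R, t) \in facts AV -> (R, map h t) \in facts (GAC AV BV).
  move=> Rt; apply/in_GAC; exists D; split; last first.
  - by apply/imfsetP; exists (R, t).
  - apply/pairwise_consistentP => S w S' w' x Sw Sw' xw xw' u.
    move=> /imfsetP[[S0 w0] /= Sw0 [eS eu]] _; rewrite -eS in Sw0.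
    rewrite eu (view_unique Sw Sw0); exists (map h w'); split; first 1 last.
    + exact: is_assignment_map.
    + by move=> y yw yw'; rewrite !value_at_map.
    by apply/imfsetP; exists (S', w').
  by apply/fsubsetP => f /imfsetP[[S w] /= Sw ->]; apply: hBV.
have actX : h X \in [seq head 0 u | u <- interp (GAC AV BV) (domv X)].
  by apply/mapP; exists [:: h X]; rewrite // in_interp (hGAC _ _ vX).
case: xs IHxs sO => [|Y xs] IHxs sO.
  by rewrite cats1; apply/mapP; exists (h X).
apply/flatten_mapP; exists (h X) => //.
rewrite -cat_rcons; apply: IHxs => // [Z YZ|R t Rt].
  by apply: sO; rewrite inE YZ orbT.
(* Fixing dom(X) to [h X] spares the trace of [h], since [[:: X]] is the only tuple of that view. *)
rewrite /= !inE hGAC //=; have [eR|//] := eqVneq R; last by rewrite orbT.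
by rewrite eR in Rt *; rewrite (view_unique vX Rt) eqxx.
Qed.

(** * Soundness for a covered pair: from consistent views to homomorphisms *)

Section Covered.
Variables (fr : elt -> symb) (A' : structure).
Hypothesis Aconn : hconnected (hypergraph_of A).
Hypothesis fr_fresh : {in O, forall X, fr X \notin voc A /\ arity (fr X) = 1}.
Hypothesis fr_inj : {in O &, injective fr}.
Hypothesis A'core : is_core A' (sunion A (unaries fr (fun X => [fset X]) O)).
Hypothesis tp : has_tree_projection (hypergraph_of A') (hypergraph_of AV).
Hypothesis sOA : O `<=` univ A.

Let A'sub := let: And3 s _ _ := A'core in s.

Lemma core_hom : exists h, [/\ {in O, forall X, h X = X},
    forall R t, (R, t) \in facts A ->
      (R, map h t) \in facts A' /\ (R, map h t) \in facts A,
    {in univ A, forall x, h x \in univ A'} &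
    {in univ A', forall y, exists2 x, x \in univ A & y = h x}].
Proof.
have [wfA _ _] := ABinst; have [_ _ _ /fsubsetP sfA'] := A'sub.
have [_ [h homh] _] := A'core; have [h_univ h_facts] := homh.
have wfA1 : wf (sunion A (unaries fr (fun X => [fset X]) O)).
  by apply: wf_sunion => //; apply: wf_unaries => X /fr_fresh[].
exists h; split.
- move=> X OX; have : (fr X, [:: h X]) \in facts A'.
    apply: (h_facts (fr X) [:: X]); rewrite inE; apply/orP; right.
    by apply/facts_unaries; exists X, X; rewrite inE.
  move/sfA'; rewrite inE => /orP[/wfA.2[/= frA]|].
    by have [/negP] := fr_fresh OX.
  move=> /facts_unaries[Y [v [OY /[!inE] /eqP -> eXY [->]]]].
  by rewrite (fr_inj OX OY eXY).
- move=> R t Rt; have Rt' : (R, map h t) \in facts A'.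
    by apply: h_facts; rewrite inE Rt.
  split=> //; have := sfA' _ Rt'; rewrite inE => /orP[//|].
  move=> /facts_unaries[X [v [OX _ eR _]]].
  have [/= RA _ _] := wfA.2 _ Rt.
  by have [] := fr_fresh OX; rewrite -eR RA.
- by move=> x xA; apply: h_univ; rewrite inE xA.
move=> y /(core_univ wfA1 A'core homh)[x + ->]; rewrite inE => xA; exists x => //.
case/orP: xA => // /univ_unaries[X OX /[!inE] /eqP->].
exact: (fsubsetP sOA).
Qed.

Section Consistent.
Variable BV : structure.
Hypotheses (sBV : facts BV `<=` facts BV0) (consBV : pairwise_consistent AV BV).

(** Consistency acts only between views with a common variable, hence the walk: along a path from
    [X] to a preimage of [y], the images under [h] of consecutive hyperedges share a variable, and a
    tuple is passed on from base view to base view. *)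
Lemma core_inhabited X a :
  X \in O -> (domv X, [:: a]) \in facts BV ->
  {in univ A', forall y, exists R t u,
    [/\ (R, t) \in facts A', (R, t) \in facts A, y \in t,
        (base_view AV (R, t), u) \in facts BV & is_assignment t u]}.
Proof.
move=> OX Xa; have [h [hO h_facts _ h_surj]] := core_hom.
have cons := pairwise_consistentP _ _ consBV.
have XX := dom_facts OX; have [XX' _] := h_facts _ _ XX.
move=> y /h_surj[z zA ->].
have [p pth <-] := Aconn (fsubsetP sOA X OX) zA.
have: exists R t u, [/\ (R, t) \in facts A', (R, t) \in facts A, h X \in t,
    (base_view AV (R, t), u) \in facts BV & is_assignment t u].
  rewrite /= hO // in XX' *; exists (dom X), [:: X], [:: a].
  by split; rewrite ?mem_head //; apply: (is_assignment_map (fun=> a)).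
elim: p (X) pth => //= w p IHp x /andP[+ pth] [R0 [t0 [u0 [_ A0 xt0 Su0 tu0]]]].
case/hasP => e /in_hypergraph_of[[R t] Rt e_t] /[!e_t] /= /andP[xt wt].
apply: (IHp w pth); have [Rt' RtA] := h_facts _ _ Rt.
have [u [Su wu _]] := cons _ _ _ _ (h x) (base_viewP A0).1 (base_viewP RtA).1
  xt0 (map_f h xt) _ Su0 tu0.
by exists R, (map h t), u; split; rewrite ?map_f.
Qed.

Lemma consistent_assignment X a :
  X \in O -> (domv X, [:: a]) \in facts BV ->
  exists2 s, s X = a &
    forall R t, (R, t) \in facts A' -> (R, t) \in facts A ->
      (base_view AV (R, t), map s t) \in facts BV.
Proof.
move=> OX Xa; have [wfA _ _] := ABinst; have [wfA' _ _ _] := A'sub.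
have [h [hO h_facts _ _]] := core_hom; have inh := core_inhabited OX Xa.
have cons := pairwise_consistentP _ _ consBV.
have XX := dom_facts OX; have [vX _] := base_viewP XX.
have XX' : (dom X, [:: X]) \in facts A'.
  by have [+ _] := h_facts _ _ XX; rewrite /= hO.
have [Ha [_ [E jt] le1 le2]] := tp.
have cover e : e \in hedges Ha ->
    exists S w, (S, w) \in facts AV /\ {subset e <= w}.
  move=> /le2[e2 /in_hypergraph_of[[S w] Sw e2_w] /fsubsetP sub].
  by exists S, w; split=> // x /sub; rewrite e2_w.
have covered R t : (R, t) \in facts A' ->
    exists2 e : {fset elt}, e \in hedges Ha & {subset t <= e}.
  move=> Rt; have : [fset x in t] \in hedges (hypergraph_of A').
    by apply/in_hypergraph_of; exists (R, t) => // x; rewrite inE.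
  by case/le1 => e He /fsubsetP sub; exists e => // x xt; rewrite sub ?inE.
(* Hyperedges of [Ha] may have nodes outside [A'], on which nothing is required. A hyperedge that
   misses [A'] satisfies [r] vacuously, in line with [inh], which speaks of [univ A'] only. *)
pose r (e : {fset elt}) (s : elt -> elt) :=
  forall x0, x0 \in e -> x0 \in univ A' -> exists S w u,
  [/\ (S, w) \in facts AV, {subset e <= w}, (S, u) \in facts BV, is_assignment w u
    & forall x, x \in e -> x \in univ A' -> s x = value_at w u x].
have r_ext (e : {fset elt}) s s' : {in e, s =1 s'} -> r e s -> r e s'.
  move=> ss' rs x0 ex0 Ax0; have [S [w [u [Sw ew Su wu su]]]] := rs x0 ex0 Ax0.
  by exists S, w, u; split=> // x ex Ax; rewrite -ss' ?su.
have r_step (e e' : {fset elt}) s : e \in hedges Ha -> e' \in hedges Ha -> r e s ->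
    exists2 s', r e' s' & forall x, x \in e -> x \in e' -> s' x = s x.
  move=> He He' rs; have [S' [w' [Sw' ew']]] := cover _ He'.
  (* If [e] and [e'] share an element of [A'], consistency extends the tuple of [e]. Otherwise any
     tuple of the view over [e'] will do, as no value within [A'] is prescribed. *)
  have [/hasP[x ex /andP[e'x Ax]]|/hasPn no] :=
      boolP (has (fun x => (x \in e') && (x \in univ A')) e).
    have [S [w [u [Sw ew Su wu su]]]] := rs x ex Ax.
    have [u' [Su' wu' eq_u]] := cons _ _ _ _ x Sw Sw' (ew x ex) (ew' x e'x) _ Su wu.
    exists (fun x => if x \in univ A' then value_at w' u' x else s x).
      by move=> _ _ _; exists S', w', u'; split=> // y _ ->.
    by move=> y ey e'y; case: ifP => // Ay; rewrite su ?eq_u ?ew ?ew'.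
  have [/hasP[x e'x Ax]|/hasPn no'] := boolP (has (mem (univ A')) e'); last first.
    by exists s => // x /no' /negPf /= ->.
  have [R [t [u [_ Rt xt Su tu]]]] := inh x Ax.
  have [u' [Su' wu' _]] := cons _ _ _ _ x (base_viewP Rt).1 Sw' xt (ew' x e'x) _ Su tu.
  exists (fun x => if x \in univ A' then value_at w' u' x else s x).
    by move=> _ _ _; exists S', w', u'; split=> // y _ ->.
  by move=> y /no; case: (y \in univ A') => //; rewrite andbT => /negPf->.
(* The root contains [X]; extending [[:: a]] to its view fixes the value at [X]. *)
have [e0 He0 Xe0] := covered _ _ XX'; have {}Xe0 := Xe0 X (mem_head _ _).
have [S0 [w0 [Sw0 ew0]]] := cover _ He0.
have [||u0 [Su0 wu0 eq_u0]] :=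
    cons _ _ _ _ X vX Sw0 (mem_head _ _) (ew0 X Xe0) [:: a] => //.
  by rewrite /is_assignment /= /value_at /= eqxx.
have r0 : r e0 (value_at w0 u0) by move=> _ _ _; exists S0, w0, u0.
have [s s_e0 rs] := join_tree_extension jt He0 r_ext r_step r0.
exists s.
  by rewrite s_e0 // eq_u0 ?mem_head ?ew0 // /value_at /= eqxx.
move=> R t Rt' RtA; have [e He te] := covered _ _ Rt'.
(* Positive arity gives [t] a variable, which discharges the guard of [r]. *)
have [x0 tx0] : exists x, x \in t.
  have [/= /wfA.1 + size_t _] := wfA.2 _ RtA; rewrite -size_t.
  by case: (t) => // x t' _; exists x; rewrite mem_head.
have [/= _ _ tA'] := wfA'.2 _ Rt'.
have [S [w [u [Sw ew Su wu su]]]] := rs e He x0 (te _ tx0) (tA' _ tx0).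
(* All variables of [t] lie in [e], hence in [w], so consistency with the view [S] pins down a whole
   tuple of the base view of [t]. *)
have [u' [Su' tu' eq_u]] := cons _ _ _ _ x0 Sw (base_viewP RtA).1 (ew _ (te _ tx0))
  tx0 _ Su wu.
suff -> : map s t = u' by [].
rewrite (eqP tu'); apply/eq_in_map => x tx.
by rewrite eq_u ?ew ?te // su ?te ?tA'.
Qed.

Lemma consistent_hom X a :
  X \in O -> (domv X, [:: a]) \in facts BV ->
  exists s, [/\ hom A B s, s X = a &
    {in O, forall Y, (domv Y, [:: s Y]) \in facts BV}].
Proof.
move=> OX Xa; have [_ wfB _] := ABinst.
have [h [hO h_facts h_univ _]] := core_hom.
have [s sX s_facts] := consistent_assignment OX Xa.
have s_hom R t : (R, t) \in facts A' -> (R, t) \in facts A ->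
    (R, map s t) \in facts B.
  move=> Rt' RtA; rewrite -in_interp; have [_ /fsubsetP -> //] := base_viewP RtA.
  by rewrite in_interp (fsubsetP sBV) ?s_facts.
exists (s \o h); split.
- split=> [x /h_univ hxA'|R t /h_facts[Rt' RtA]]; last by rewrite map_comp s_hom.
  (* The value lies in [univ B] because every element of [A'] occurs in a fact shared with [A],
     whose image is a fact of [B]. *)
  have [R [t [_ [Rt' RtA xt _ _]]]] := core_inhabited OX Xa hxA'.
  have [_ _ ->//] := wfB.2 _ (s_hom _ _ Rt' RtA).
  exact: map_f.
- by rewrite /= hO.
move=> Y OY; have [/= + +] := h_facts _ _ (dom_facts OY).
by rewrite hO //; exact: s_facts.
Qed.
End Consistent.

(* The hypothesis on [prefix] says that the views dom(X) of the processed
   variables admit no other values than those listed in it. *)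
Lemma propagate_sound (xs : seq elt) BV (processed prefix a : seq elt) :
  {subset xs <= O} -> {subset processed <= O} -> facts BV `<=` facts BV0 ->
  (forall s, {in processed, forall X, (domv X, [:: s X]) \in facts BV} ->
     prefix = map s processed) ->
  a \in propagate domv AV BV prefix xs ->
  exists2 s, hom A B s & a = map s (processed ++ xs).
Proof.
elim: xs BV processed prefix => // X xs IHxs BV processed prefix sxs sproc sBV inv /=.
have OX : X \in O by rewrite sxs ?mem_head.
have sGAC := GAC_sub AV BV; have sGAC0 := fsubset_trans sGAC sBV.
(* By legality the tuples of the base view dom(X) are unary, so [head 0] loses nothing and its
   default never shows. *)
have act b : b \in [seq head 0 u | u <- interp (GAC AV BV) (domv X)] ->
    (domv X, [:: b]) \in facts (GAC AV BV).
  move=> /mapP[u Xu ->]; have := Xu; rewrite !in_interp => Xu'.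
  suff /eqP : size u = 1 by case: u Xu' {Xu} => [|c []].
  have [_ /fsubsetP sB] := base_viewP (dom_facts OX).
  have : u \in interp B (dom X).
    by apply: sB; rewrite in_interp (fsubsetP sGAC0).
  have [wfA [_ wfB] _] := ABinst.
  rewrite in_interp => /wfB[_ /= -> _].
  by have [_ <- _] := wfA.2 _ (dom_facts OX).
case: xs IHxs sxs => [|Y xs] IHxs sxs.
  move=> /mapP[b /act Xb ->].
  (* [s] takes its values in the views dom(Z) of the processed variables, and [inv] reads the prefix
     off from them. *)
  have [s [homs sX sO]] := consistent_hom sGAC0 (GAC_consistent _ _) OX Xb.
  exists s => //; rewrite cats1 map_rcons sX (inv s) // => Z /sproc/sO.
  exact: (fsubsetP sGAC).
move=> /flatten_mapP[b /act Xb]; rewrite -cat_rcons.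
set BV' := set_unary _ _ _; have sBV' : facts BV' `<=` facts (GAC AV BV).
  by apply/fsubsetP => f; rewrite !inE => /orP[/eqP->|/andP[]].
apply: IHxs.
- by move=> Z YZ; apply: sxs; rewrite inE YZ orbT.
- by move=> Z; rewrite mem_rcons inE => /orP[/eqP->|/sproc].
- exact: fsubset_trans sBV' sGAC0.
move=> s sprocX; rewrite map_rcons; congr rcons.
  apply: inv => Z dZ; apply: (fsubsetP sGAC); apply: (fsubsetP sBV').
  by apply: sprocX; rewrite mem_rcons inE dZ orbT.
(* After [set_unary] the view dom(X) holds only [[:: b]], which forces [s X = b]. *)
have := sprocX X; rewrite mem_rcons mem_head !inE => /(_ isT).
by rewrite eqxx andbF orbF => /eqP[->].
Qed.

End Covered.
End Views.

(** Covering is assumed for [dom_left dom A O], the structure on which the algorithm runs the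
    method; it is [A] itself when all variables of [O] are domain restricted. *)
Theorem theorem3 (DM : decomposition_method) (A : structure) (O : {fset elt})
    (xs : seq elt) (dom : elt -> symb) :
  wf A -> hconnected (hypergraph_of A) ->
  O `<=` univ A -> uniq xs -> xs =i O -> 0 < size xs ->
  fresh_dom dom A O ->
  tp_covered DM (dom_left dom A O) O ->
  forall B : structure, csp_instance A B ->
  forall vals : elt -> {fset elt},
  {in unrestricted dom A O, forall X, domain_values A B X (vals X)} ->
  forall a : seq elt,
    a \in ComputeAllSolutions DM dom vals A B xs <-> restricted_homs A B xs a.
Proof.
move=> wfA connA sOA _ xsO xs_gt0 dom_fresh tp B ABinst vals vals_dom a.
have [fr [fr_fresh fr_inj [A' A'core treeproj]]] := tp.
rewrite /ComputeAllSolutions.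
have -> : [fset X in xs] = O by apply/fsetP => X; rewrite !inE xsO.
set A1 := dom_left dom A O in tp fr_fresh A'core treeproj *.
set B1 := dom_right dom vals A B O.
have inst1 : csp_instance A1 B1 by apply: csp_instance_dom.
have view1 := lDM_views DM inst1; have legal1 := rDM_legal DM inst1.
have dom_facts : {in O, forall X, (dom X, [:: X]) \in facts A1}.
  by move=> X OX; apply/(dom_fact ABinst dom_fresh).
have sxsO : {subset xs <= O} by move=> X; rewrite xsO.
have univA1 : univ A1 = univ A by apply: univ_dom_left.
have conn1 : hconnected (hypergraph_of A1).
  by apply: hconnected_sub connA => //; apply: fsubsetUl.
have sOA1 : O `<=` univ A1 by rewrite univA1.
split=> [|[h homh ->]].
  case/(propagate_sound inst1 view1 legal1 dom_facts conn1 fr_fresh fr_inj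
          A'core treeproj sOA1 (processed := [::])) => // s homs ->.
  by exists s => //; apply/(hom_dom ABinst sOA dom_fresh vals_dom).
apply: (propagate_complete view1 legal1 dom_facts [::]) => //.
  by rewrite -size_eq0 -lt0n.
(* Legality puts the trace of every homomorphism into the initial views. *)
move=> R t Rt; have [_ _ supp _] := legal1; rewrite -in_interp; apply: supp Rt _ _.
by exists h => //; apply/(hom_dom ABinst sOA dom_fresh vals_dom).
Qed.
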